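(* Let $H$ be a graph and $T\subseteq V(H)$ with $|T|$ odd. Let $G=G(\mathcal{TS}(H,T))$ and $\tilde G=\tilde G(\mathcal{TS}(H,T))$. Then there is a degree-$2$ Nullstellensatz refutation of $\mathsf P_{\mathrm{iso}}(G,\tilde G)$ over $\mathbb F_2$.
   Context: Tseitin CSP $\mathcal{TS}(H,T)$ over $\mathbb Z_2$: there is a variable $z_e$ for every edge $e\in E(H)$. For each vertex $v\in V(H)$, with incident edges $e_1,\dots,e_k$ in some fixed arbitrary order, let $\Delta=\{(i_1,\dots,i_k)\in\mathbb Z_2^k:\sum_j i_j=0\}$; the constraint $C_v$ is $((z_{e_1},\dots,z_{e_k}),R_v)$ with $R_v=\Delta$ if $v\notin T$ and $R_v=\Delta+(1,0,\dots,0)$ if $v\in T$. The coloured graph $G=G(\mathcal{TS}(H,T))$: for each edge $e$ there are vertices $0^{(e)},1^{(e)}$, both with colour $L^{(e)}$; for each vertex $v\in V(H)$ (incident edges $e_1,\dots,e_k$) there are vertices $\beta^{(v)}$ for all $\beta=(\beta_1,\dots,\beta_k)\in R_v$, all with colour $L^{(v)}$, and for each such $\beta$ and $i\in[k]$ an edge $\{\beta^{(v)},\beta_i^{(e_i)}\}$ of colour $M^{(i)}$. The graph $\tilde G=\tilde G(\mathcal{TS}(H,T))$ is defined identically except that $R_v$ is replaced by $\Delta$ for every $v$ (colours $L^{(e)},L^{(v)},M^{(i)}$ are the same as in $G$). Coloured graphs: isomorphisms and local isomorphisms preserve vertex and edge colours. A local isomorphism from $G$ to $\tilde G$ is an injective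 colour-preserving map $\pi$ with domain in $V(G)$ and range in $V(\tilde G)$ (a subset of $V(G)\times V(\tilde G)$) with $vv'\in E(G)\iff\pi(v)\pi(v')\in E(\tilde G)$, edge colours preserved. $\mathsf P_{\mathrm{iso}}(G,\tilde G)$ in variables $x_{vw}$ ($v\in V(G)$, $w\in V(\tilde G)$) consists of: $\sum_{v\in V(G)}x_{vw}-1$ for all $w$; $\sum_{w\in V(\tilde G)}x_{vw}-1$ for all $v$; and $x_{vw}x_{v'w'}$ whenever $\{(v,w),(v',w')\}$ is not a local isomorphism. A degree-$d$ Nullstellensatz refutation of a set $\mathsf P$ of polynomials over a field $\mathbb F$ consists of polynomials $f_p$ ($p\in\mathsf P$) and $g_x$ (for all variables $x$) with $\sum_{p\in\mathsf P}f_pp+\sum_x g_x(x^2-x)=1$, where the degree is the maximum degree of the polynomials $f_pp$. *)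

(* Defs.v *)
From HB Require Import structures.
From mathcomp Require Import all_boot all_order all_algebra finmap.
From mathcomp Require Import mpoly.

Set Implicit Arguments.
Unset Strict Implicit.
Unset Printing Implicit Defensive.

Import GRing.Theory.
Local Open Scope ring_scope.

Section NullstellensatzRefutation.
Variables (F : fieldType) (n : nat).
Implicit Types (P : {fset {mpoly F[n]}}) (f : {mpoly F[n]} -> {mpoly F[n]}).

Definition ns_refutation P f (g : 'I_n -> {mpoly F[n]}) : Prop :=
  \sum_(p <- P) f p * p + \sum_(i < n) g i * ('X_i ^+ 2 - 'X_i) = 1.

(* [msize p] is one more than the total degree of [p], and [msize 0 = 0]. *)
Definition ns_degree P f : nat := (\max_(p <- P) (msize (f p * p)).-1)%N.

Definition has_ns_refutation (d : nat) P : Prop :=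
  exists f g, ns_refutation P f g /\ (ns_degree P f <= d)%N.

End NullstellensatzRefutation.

(* [ecol x y] is meaningful only when [x] and [y] are adjacent. *)
Record cgraph (LV LE : eqType) := CGraph {
  cvert :> finType;
  vcol : cvert -> LV;
  adj : rel cvert;
  ecol : cvert -> cvert -> LE;
  adj_sym : ssrbool.symmetric adj;
  adj_irr : irreflexive adj;
  ecol_sym : forall x y, ecol x y = ecol y x
}.

Section GraphIsomorphism.
Variables (LV LE : eqType) (G G' : cgraph LV LE).

(* The first conjunct says that [pi] is (the graph of) an injective partial
   function. *)
Definition local_iso (pi : {set G * G'}) : bool :=
  [forall a in pi, forall b in pi,
    [&& (a.1 == b.1) == (a.2 == b.2),
        vcol a.1 == vcol a.2,
        adj a.1 b.1 == adj a.2 b.2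
      & adj a.1 b.1 ==> (ecol a.1 b.1 == ecol a.2 b.2)]].

Variable F : fieldType.

Definition niso_vars : nat := #|{: G * G'}|.

Definition iso_var (v : G) (w : G') : {mpoly F[niso_vars]} :=
  'X_(enum_rank (v, w)).

(* A pair [a.1 = a.2] is allowed: it contributes the square of a variable
   whose two vertices have different colours. *)
Definition Piso : {fset {mpoly F[niso_vars]}} :=
  ([fset (\sum_(v : G) iso_var v w - 1) | w in G']
   `|` [fset (\sum_(w : G') iso_var v w - 1) | v in G]
   `|` [fset (iso_var a.1.1 a.1.2 * iso_var a.2.1 a.2.2)
         | a in [pred a : (G * G') * (G * G')
                   | ~~ local_iso [set a.1; a.2]]])%fset.

End GraphIsomorphism.

Record sgraph := SGraph {
  svert :> finType;
  sadj : rel svert;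
  sadj_sym : ssrbool.symmetric sadj;
  sadj_irr : irreflexive sadj
}.

Section Tseitin.
Variable H : sgraph.

Definition edge_set : {set {set H}} :=
  [set e | [exists u, exists v, sadj u v && (e == [set u; v])]].

Definition edge : finType := {e : {set H} | e \in edge_set}.

(* [inc v] lists the edges incident to [v], in an arbitrary order. *)
Definition incidence_order (inc : H -> seq edge) : Prop :=
  forall v, perm_eq (inc v) (enum [pred e : edge | v \in val e]).

Variable inc : H -> seq edge.

Definition inc_edge v (i : 'I_(size (inc v))) : edge := tnth (in_tuple (inc v)) i.

Definition Delta k : {set 'rV['F_2]_k} :=
  [set b : 'rV['F_2]_k | \sum_(i < k) b ord0 i == 0].

(* The coset [Delta k + (1, 0, .., 0)]. For [k = 0] there is no first unit
   vector and the set is empty, in accordance with the unsatisfiable empty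
   equation [0 = 1]. *)
Definition Delta1 k : {set 'rV['F_2]_k} :=
  [set b + delta_mx ord0 i | b in Delta k, i in [pred i : 'I_k | i == 0 :> nat]].

Definition Tseitin_rel (T : {set H}) v : {set 'rV['F_2]_(size (inc v))} :=
  if v \in T then Delta1 _ else Delta _.

Section Graph.
Variable R : forall v : H, {set 'rV['F_2]_(size (inc v))}.

Definition constraint_vert (v : H) : finType :=
  {b : 'rV['F_2]_(size (inc v)) | b \in R v}.

(* [inl (e, a)] is a^(e) and [inr (Tagged _ b)], with [b : constraint_vert v],
   is b^(v); the colours L^(e), L^(v) are [inl e], [inr v], and the edge colour
   M^(i) is the 0-based position of the edge in [inc v]. *)
Definition csp_vert : finType := (edge * 'F_2 + {v : H & constraint_vert v})%type.

Definition csp_vcol (x : csp_vert) : (edge + H)%type :=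
  match x with inl ea => inl ea.1 | inr vb => inr (tag vb) end.

Definition csp_link (vb : {v : H & constraint_vert v}) (ea : edge * 'F_2) : bool :=
  [exists i : 'I_(size (inc (tag vb))),
    (inc_edge i == ea.1) && (val (tagged vb) ord0 i == ea.2)].

Definition csp_adj (x y : csp_vert) : bool :=
  match x, y with
  | inr vb, inl ea | inl ea, inr vb => csp_link vb ea
  | _, _ => false
  end.

Definition csp_ecol (x y : csp_vert) : nat :=
  match x, y with
  | inr vb, inl ea | inl ea, inr vb => index ea.1 (inc (tag vb))
  | _, _ => 0%N
  end.

Lemma csp_adj_sym : ssrbool.symmetric csp_adj.
Proof. by move=> [x|x] [y|y]. Qed.

Lemma csp_adj_irr : irreflexive csp_adj.
Proof. by case. Qed.

Lemma csp_ecol_sym x y : csp_ecol x y = csp_ecol y x.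
Proof. by case: x => x; case: y => y. Qed.

Definition csp_graph : cgraph (edge + H)%type nat :=
  CGraph csp_vcol csp_adj_sym csp_adj_irr csp_ecol_sym.

End Graph.

Definition Tseitin_graph (T : {set H}) := csp_graph (Tseitin_rel T).

Definition Tseitin_graph_tilde := csp_graph (fun v => Delta (size (inc v))).

End Tseitin.

(* Main.v *)
Require Import Defs.
From mathcomp Require Import all_boot all_order all_algebra finmap.
From mathcomp Require Import mpoly.

(** Write [x_(v,w)] for the variable "v is mapped to w". For an edge [e] of [H]
    let [z_e = x_(0^(e),1^(e))] say that [e] is flipped. If [b^(v)] is mapped to
    [c^(v)], then exactly the edges at which [b] and [c] differ are flipped:
    [z_e x_(b,c) = (b_e + c_e) x_(b,c)] is a degree-2 consequence of the axioms.
    Fix [c] in Delta. Summing over the edges at [v], every preimage [b^(v)] of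
    [c^(v)] satisfies [(\sum_(e at v) z_e) x_(b,c) = [v \in T] x_(b,c)], and the
    axiom that [c^(v)] has a preimage turns this into
    [\sum_(e at v) z_e = [v \in T]], also when the constraint at [v] is
    unsatisfiable. As every edge has two ends, the sum of these equations over
    all vertices is [0 = |T| = 1]. *)

Set Implicit Arguments.
Unset Strict Implicit.
Unset Printing Implicit Defensive.

Import GRing.Theory.
Local Open Scope ring_scope.

Lemma msizeM_leq (R : idomainType) n (p q : {mpoly R[n]}) k :
  (msize p + msize q <= k.+1)%N -> (msize (p * q) <= k)%N.
Proof.
have [->|p_neq0] := eqVneq p 0; first by rewrite mul0r mmeasure0.
have [->|q_neq0] := eqVneq q 0; first by rewrite mulr0 mmeasure0.
by rewrite msizeM // -subn1 leq_subLR.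
Qed.

Lemma msize_sum_varsB (R : nzRingType) n (I : finType) (E : I -> 'I_n) (a : R) :
  (msize (\sum_i 'X_(E i) - a%:MP) <= 2)%N.
Proof.
apply: leq_trans (mmeasureD_le _ _ _) _; rewrite mmeasureN geq_max mmeasureC.
rewrite (leq_trans (leq_b1 _)) // andbT.
apply: leq_trans (mmeasure_sum _ _ _ _) _.
by apply/bigmax_leqP => i _; rewrite msizeX mdeg1.
Qed.

Section Derivations.
Variables (F : fieldType) (n d : nat) (P : {fset {mpoly F[n]}}).
Implicit Types (p q l : {mpoly F[n]}).

Definition ns_derivable q : Prop :=
  exists f g, \sum_(p <- P) f p * p + \sum_(i < n) g i * ('X_i ^+ 2 - 'X_i) = q
              /\ (ns_degree P f <= d)%N.

Lemma ns_degree_leqP (f : {mpoly F[n]} -> {mpoly F[n]}) :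
  reflect (forall p, p \in P -> (msize (f p * p) <= d.+1)%N)
          (ns_degree P f <= d)%N.
Proof.
apply: (iffP (bigmax_leqP_seq _ _ _ _)) => [le_d p pP | le_d p pP _].
  by rewrite -add1n -leq_subLR subn1 le_d.
by rewrite -subn1 leq_subLR le_d.
Qed.

Lemma ns_derivable0 : ns_derivable 0.
Proof.
exists (fun=> 0), (fun=> 0); split.
  by rewrite !big1 ?addr0 // => i _; rewrite mul0r.
by apply/ns_degree_leqP => p _; rewrite mul0r mmeasure0.
Qed.

Lemma ns_derivableD p q :
  ns_derivable p -> ns_derivable q -> ns_derivable (p + q).
Proof.
move=> [f [g [<- /ns_degree_leqP df]]] [f' [g' [<- /ns_degree_leqP df']]].
exists (fun r => f r + f' r), (fun i => g i + g' i); split.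
  rewrite addrACA -!big_split /=.
  by congr (_ + _); apply: eq_bigr => i _; rewrite mulrDl.
apply/ns_degree_leqP => r rP; rewrite mulrDl.
by apply: leq_trans (mmeasureD_le _ _ _) _; rewrite geq_max df ?df'.
Qed.

Lemma ns_derivableZ a p : ns_derivable p -> ns_derivable (a *: p).
Proof.
move=> [f [g [<- /ns_degree_leqP df]]].
exists (fun r => a *: f r), (fun i => a *: g i); split.
  rewrite scalerDr !scaler_sumr.
  by congr (_ + _); apply: eq_bigr => i _; rewrite scalerAl.
apply/ns_degree_leqP => r rP; rewrite -scalerAl.
exact: leq_trans (msizeZ_le _ _) (df r rP).
Qed.

Lemma ns_derivableB p q :
  ns_derivable p -> ns_derivable q -> ns_derivable (p - q).
Proof. by move=> dp dq; rewrite -scaleN1r; apply/ns_derivableD/ns_derivableZ. Qed.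

Lemma ns_derivable_sum (I : Type) (r : seq I) (Q : pred I)
    (E : I -> {mpoly F[n]}) :
  (forall i, Q i -> ns_derivable (E i)) -> ns_derivable (\sum_(i <- r | Q i) E i).
Proof.
move=> dE; apply: big_ind => //; [exact: ns_derivable0 | exact: ns_derivableD].
Qed.

Lemma ns_derivable_axiom l p :
  p \in P -> (msize (l * p) <= d.+1)%N -> ns_derivable (l * p).
Proof.
move=> pP dlp; exists (fun r => if r == p then l else 0), (fun=> 0); split.
  rewrite [X in _ + X]big1 ?addr0 => [|i _]; last by rewrite mul0r.
  rewrite (bigD1_seq p) ?fset_uniq //= eqxx big1 ?addr0 // => r /negPf->.
  by rewrite mul0r.
apply/ns_degree_leqP => r rP; case: eqP => [->//|_].
by rewrite mul0r mmeasure0.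
Qed.

Lemma ns_derivable_boolean i : ns_derivable ('X_i ^+ 2 - 'X_i).
Proof.
exists (fun=> 0), (fun j => (j == i)%:R); split.
  rewrite big1 ?add0r => [|r _]; last by rewrite mul0r.
  rewrite (bigD1 i) //= eqxx mul1r big1 ?addr0 // => j /negPf->.
  by rewrite mul0r.
by apply/ns_degree_leqP => r rP; rewrite mul0r mmeasure0.
Qed.

End Derivations.

Section LocalIsomorphisms.
Variables (LV LE : eqType) (G G' : cgraph LV LE) (pi : {set G * G'}).
Hypothesis pi_local_iso : local_iso pi.

Lemma local_iso_vcol a : a \in pi -> vcol a.1 = vcol a.2.
Proof.
move=> a_pi; move/forall_inP/(_ a a_pi)/forall_inP/(_ a a_pi): pi_local_iso.
by case/and4P=> _ /eqP.
Qed.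

Lemma local_iso_adj a b : a \in pi -> b \in pi -> adj a.1 b.1 = adj a.2 b.2.
Proof.
move=> a_pi b_pi.
move/forall_inP/(_ a a_pi)/forall_inP/(_ b b_pi): pi_local_iso.
by case/and4P=> _ _ /eqP.
Qed.

End LocalIsomorphisms.

Section PisoDerivations.
Variables (LV LE : eqType) (G G' : cgraph LV LE) (F : fieldType) (d : nat).
Hypothesis d_gt1 : (1 < d)%N.
Implicit Types (v : G) (w : G') (l : {mpoly F[niso_vars G G']}).
Local Notation x := (@iso_var LV LE G G' F).
Local Notation derivable := (ns_derivable d (Piso G G' F)).

Lemma msize_iso_var v w : msize (x v w) = 2%N.
Proof. by rewrite msizeX mdeg1. Qed.

Lemma iso_var_enum_val i : 'X_i = x (enum_val i).1 (enum_val i).2.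
Proof. by rewrite /iso_var -surjective_pairing enum_valK. Qed.

Lemma derivable_preimage_axiom l w :
  (msize l <= d)%N -> derivable (l * (\sum_(v : G) x v w - 1)).
Proof.
move=> dl; apply: ns_derivable_axiom.
  by rewrite !in_fsetU; apply/orP; left; apply/orP; left; apply/imfsetP; exists w.
have msize_sum : (msize (\sum_(v : G) x v w - 1) <= 2)%N.
  by rewrite -mpolyC1; apply: msize_sum_varsB.
by apply: msizeM_leq; rewrite -addn2 leq_add.
Qed.

Lemma derivable_nonlocal_axiom l v v' w w' :
    (msize l < d)%N -> ~~ local_iso [set (v, w); (v', w')] ->
  derivable (l * (x v w * x v' w')).
Proof.
move=> dl nonlocal; apply: ns_derivable_axiom.
  rewrite !in_fsetU; apply/orP; right.
  by apply/imfsetP; exists ((v, w), (v', w')).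
have msize_xx : (msize (x v w * x v' w') <= 3)%N.
  by apply: msizeM_leq; rewrite !msize_iso_var.
apply: msizeM_leq; apply: leq_trans (leq_add (leqnn _) msize_xx) _.
by rewrite addn3 !ltnS.
Qed.

Lemma derivable_nonlocal v v' w w' :
  ~~ local_iso [set (v, w); (v', w')] -> derivable (x v w * x v' w').
Proof.
by rewrite -[_ * _]mul1r => ?; apply: derivable_nonlocal_axiom; rewrite ?msize1.
Qed.

Lemma derivable_vcol_neq l v w :
  (msize l <= d)%N -> vcol v != vcol w -> derivable (l * x v w).
Proof.
move=> dl ncol.
have nonlocal v' w' : ~~ local_iso [set (v', w'); (v, w)].
  by apply: contra ncol => /local_iso_vcol/(_ _ (set22 _ _))/eqP.
rewrite [l]mpolyE mulr_suml big_seq; apply: ns_derivable_sum => m m_l.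
rewrite -scalerAl; apply: ns_derivableZ.
have [->|] := eqVneq m 0%MM.
  rewrite mpolyX0 mul1r -[x v w](subKr (x v w ^+ 2)).
  apply: ns_derivableB; last exact: ns_derivable_boolean.
  by rewrite expr2; apply: derivable_nonlocal.
rewrite -mdeg_eq0 mdegE sum_nat_eq0 => /forallPn[i]; rewrite -lep1mP => i_m.
have mdeg_m : mdeg m = (mdeg (m - U_(i))).+1.
  by rewrite -[in LHS](submK i_m) mdegD mdeg1 addn1.
rewrite -(submK i_m) mpolyXD -mulrA iso_var_enum_val.
apply: derivable_nonlocal_axiom => //.
by rewrite msizeX -mdeg_m (leq_trans (msize_mdeg_lt m_l)).
Qed.

Lemma derivable_by_preimage l w :
    (msize l <= d)%N ->
    (forall v, vcol v = vcol w -> derivable (l * x v w)) ->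
  derivable l.
Proof.
move=> dl dlx.
have -> : l = \sum_(v : G) l * x v w - l * (\sum_(v : G) x v w - 1).
  by rewrite -mulr_sumr mulrBr mulr1 subKr.
apply: ns_derivableB; last exact: derivable_preimage_axiom.
apply: ns_derivable_sum => v _.
by have [/dlx|/(derivable_vcol_neq dl)] := eqVneq (vcol v) (vcol w).
Qed.

Lemma derivable_unique_preimage v w u u' :
    (forall v', v' != v -> vcol v' = vcol w ->
       ~~ local_iso [set (v', w); (u, u')]) ->
  derivable (x v w * x u u' - x u u').
Proof.
move=> nonlocal; set y := x u u'.
have -> : x v w * y - y =
    y * (\sum_(v' : G) x v' w - 1) - \sum_(v' : G | v' != v) x v' w * y.
  rewrite -mulr_suml mulrBr mulr1 (bigD1 v) //= mulrDr.
  by rewrite ![y * _]mulrC addrAC addrK.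
apply: ns_derivableB.
  by apply: derivable_preimage_axiom; rewrite msize_iso_var.
apply: ns_derivable_sum => v' v'_neq.
have [eq_col|ncol] := eqVneq (vcol v') (vcol w).
  exact/derivable_nonlocal/nonlocal.
by rewrite mulrC; apply: derivable_vcol_neq; rewrite ?msize_iso_var.
Qed.

End PisoDerivations.

Lemma F2_eq_neq (a b c : 'F_2) : a != b -> (a == c) = (b != c).
Proof. by case: a b c => [[|[|[]]] // ?] [[|[|[]]] // ?] [[|[|[]]] // ?]. Qed.

Lemma F2_addE (a b : 'F_2) : a + b = (a != b)%:R.
Proof. by apply/val_inj; case: a b => [[|[|[]]] // ?] [[|[|[]]] // ?]. Qed.

Lemma F2_natr_odd n : n%:R = (odd n)%:R :> 'F_2.
Proof.
rewrite -[in LHS](odd_double_half n) natrD -addnn natrD.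
by rewrite [X in _ + X]F2_addE eqxx addr0.
Qed.

Lemma mpoly_F2_addrr n (p : {mpoly 'F_2[n]}) : p + p = 0.
Proof. by rewrite -[p]scale1r -scalerDl F2_addE eqxx scale0r. Qed.

Lemma card_edge (H : sgraph) (e : edge H) : #|val e| = 2.
Proof.
case: e => e /=; rewrite inE => /existsP[u /existsP[v /andP[uv /eqP->]]].
rewrite cards2; case: eqVneq uv => // ->.
by rewrite sadj_irr.
Qed.

Section Incidence.
Variables (H : sgraph) (inc : H -> seq (edge H)).
Hypothesis inc_order : incidence_order inc.

Lemma inc_edge_inj v : injective (@inc_edge H inc v).
Proof. by apply/tuple_uniqP; rewrite (perm_uniq (inc_order v)) enum_uniq. Qed.

Lemma handshake (V : nmodType) (f : edge H -> V) :
  \sum_v \sum_(i < size (inc v)) f (inc_edge i) = (\sum_e f e) *+ 2.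
Proof.
have sum_incident v :
    \sum_(i < size (inc v)) f (inc_edge i) = \sum_(e : edge H | v \in val e) f e.
  by rewrite -(big_tnth _ _ _ xpredT) (perm_big _ (inc_order v)) big_enum.
under eq_bigr do rewrite sum_incident.
rewrite (exchange_big_dep predT) //= -sumrMnl; apply: eq_bigr => e _.
by rewrite sumr_const card_edge.
Qed.

End Incidence.

Section CSPRefutation.
Variables (H : sgraph) (inc : H -> seq (edge H)).
Hypothesis inc_order : incidence_order inc.
Local Notation vectors v := {set 'rV['F_2]_(size (inc v))}.

Section ConstraintVertices.
Variable R : forall v, vectors v.

Definition edge_vertex (e : edge H) (a : 'F_2) : csp_graph R := inl (e, a).

Definition constraint_vertex v (b : constraint_vert R v) : csp_graph R :=
  inr (Tagged (constraint_vert R) b).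

Lemma adj_edge_constraint v (b : constraint_vert R v) i a :
  adj (edge_vertex (inc_edge i) a) (constraint_vertex b) = (val b ord0 i == a).
Proof.
apply/existsP/eqP => [[j /andP[/eqP/(inc_edge_inj inc_order)-> /eqP]]//|<-].
by exists i; rewrite !eqxx.
Qed.

End ConstraintVertices.

Variables (R R' : forall v, vectors v) (t t' : H -> 'F_2).
Hypothesis R_parity : forall v b, b \in R v -> \sum_i b ord0 i = t v.
Hypothesis R'_parity : forall v c, c \in R' v -> \sum_i c ord0 i = t' v.
Hypothesis R'_neq0 : forall v, R' v != set0.

Local Notation G := (csp_graph R).
Local Notation G' := (csp_graph R').
Local Notation x := (@iso_var _ _ G G' 'F_2).
Local Notation derivable := (ns_derivable 2 (Piso G G' 'F_2)).

Definition flip_var e := x (edge_vertex R e 0) (edge_vertex R' e 1).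

Lemma derivable_flip v (b : constraint_vert R v) (c : constraint_vert R' v) i :
  let y := x (constraint_vertex b) (constraint_vertex c) in
  derivable (flip_var (inc_edge i) * y - (val b ord0 i + val c ord0 i) *: y).
Proof.
move=> y; rewrite F2_addE.
have adj_neq a : (val b ord0 i == a) != (val c ord0 i == 1) ->
    ~~ local_iso
         [set (edge_vertex R (inc_edge i) a, edge_vertex R' (inc_edge i) 1);
              (constraint_vertex b, constraint_vertex c)].
  apply: contra => /local_iso_adj/(_ _ _ (set21 _ _) (set22 _ _)).
  by rewrite /fst /snd !adj_edge_constraint => ->.
have [eq_bc|neq_bc] := eqVneq (val b ord0 i) (val c ord0 i).
  rewrite scale0r subr0; apply: derivable_nonlocal => //.
  apply: adj_neq; rewrite eq_bc ![val c _ _ == _]eq_sym (@F2_eq_neq 0 1) //.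
  by case: (1 == _).
rewrite scale1r; apply: derivable_unique_preimage => // -[[e a]|//] + [e_def].
rewrite -[inl _]/(edge_vertex R e a) e_def => a_neq; apply: adj_neq.
have a_neq0 : a != 0 by apply: contra a_neq => /eqP->.
have /eqP-> : a == 1 by rewrite (F2_eq_neq _ a_neq0).
by rewrite (F2_eq_neq _ neq_bc); case: (_ == 1).
Qed.

Lemma derivable_vertex_equation v :
  derivable (\sum_(i < size (inc v)) flip_var (inc_edge i) - (t v + t' v)%:MP).
Proof.
have /set0Pn[c c_R'] := R'_neq0 v.
pose c' : constraint_vert R' v := exist _ c c_R'.
apply: (@derivable_by_preimage _ _ _ _ _ _ _ _ (constraint_vertex c')) => //.
  exact: msize_sum_varsB.
move=> [//|[u b]] /= [u_def]; move: b; rewrite {u}u_def => b.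
rewrite -[inr _]/(constraint_vertex b) mulrBl mul_mpolyC.
rewrite -(R_parity (valP b)) -(R'_parity c_R') -big_split /=.
rewrite mulr_suml scaler_suml -sumrB; apply: ns_derivable_sum => i _.
exact: (derivable_flip b c').
Qed.

Lemma sum_vertex_equations :
  \sum_v (\sum_(i < size (inc v)) flip_var (inc_edge i) - (t v + t' v)%:MP) =
  - (\sum_v t v + \sum_v t' v)%:MP.
Proof.
rewrite sumrB (handshake inc_order) mulr2n mpoly_F2_addrr sub0r.
by rewrite -rmorph_sum big_split.
Qed.

Lemma csp_ns_refutation :
  \sum_v t v != \sum_v t' v -> has_ns_refutation 2 (Piso G G' 'F_2).
Proof.
move=> t_neq; rewrite -[has_ns_refutation _ _]/(derivable 1).
have := sum_vertex_equations; rewrite F2_addE t_neq mpolyC1 => sum_eq.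
rewrite -[1]opprK -sum_eq -scaleN1r; apply: ns_derivableZ.
by apply: ns_derivable_sum => v _; apply: derivable_vertex_equation.
Qed.

End CSPRefutation.

Lemma sum_Delta k b : b \in Delta k -> \sum_i b ord0 i = 0.
Proof. by rewrite inE => /eqP. Qed.

Lemma sum_Delta1 k b : b \in Delta1 k -> \sum_i b ord0 i = 1.
Proof.
case/imset2P => c i /sum_Delta sum_c _ ->.
under eq_bigr do rewrite mxE; rewrite big_split /= sum_c add0r.
rewrite (bigD1 i) //= mxE !eqxx big1 ?addr0 // => j /negPf j_neq.
by rewrite mxE j_neq andbF.
Qed.

Lemma sum_Tseitin_rel (H : sgraph) (inc : H -> seq (edge H)) (T : {set H}) v b :
  b \in Tseitin_rel inc T v -> \sum_i b ord0 i = (v \in T)%:R.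
Proof.
by rewrite /Tseitin_rel; case: ifP => _; [apply: sum_Delta1 | apply: sum_Delta].
Qed.

Lemma Delta_neq0 k : Delta k != set0.
Proof. by apply/set0Pn; exists 0; rewrite inE big1 // => i _; rewrite mxE. Qed.

Theorem theorem4 (H : sgraph) (T : {set H}) (inc : H -> seq (edge H)) :
  incidence_order inc -> odd #|T| ->
  has_ns_refutation 2 (Piso (Tseitin_graph inc T) (Tseitin_graph_tilde inc) 'F_2).
Proof.
move=> inc_order T_odd.
apply: (@csp_ns_refutation _ _ inc_order _ _ (fun v => (v \in T)%:R) (fun=> 0)).
- by move=> v b; apply: sum_Tseitin_rel.
- by move=> v c; apply: sum_Delta.
- by move=> v; apply: Delta_neq0.
have -> : \sum_v (v \in T)%:R = #|T|%:R :> 'F_2.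
  by rewrite -sumr_const [RHS]big_mkcond; apply: eq_bigr => v _; case: ifP.
by rewrite F2_natr_odd T_odd sumr_const mul0rn oner_eq0.
Qed.
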